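(* There is an absolute constant $C>0$ such that for every $p\in(0,1/2]$, every shape $\tau$ and every even integer $t\ge2$, with $\mathbf M_\tau$ the graph matrix of $\tau$ for the $p$-biased random graph, $$\mathbb E\|\mathbf M_\tau-\mathbb E\mathbf M_\tau\|_{2t}^{2t}\le\Big(n^{|V(\tau)|}\,|V(\tau)|^{t|V(\tau)|}\,(Ct^3|E(\tau)|^5)^{t|E(\tau)|}\Big)\max_{S}\Big(\frac{1-p}{p}\Big)^{t|E(S)|}n^{t(|V(\tau)|-|S|+|I_\tau|)},$$ where the maximum is over all vertex separators $S$ of $\tau$.
   Context: $p$-biased random graph: for each unordered pair $\{i,j\}$ of distinct elements of $[n]$ there is a variable $G_{i,j}=G_{j,i}$; these are independent, each equal to $-\sqrt{(1-p)/p}$ with probability $p$ and $\sqrt{p/(1-p)}$ with probability $1-p$ (so mean $0$, variance $1$). A shape $\tau=(V(\tau),E(\tau),U_\tau,V_\tau)$ is a finite graph with two ordered subsets $U_\tau,V_\tau\subseteq V(\tau)$; a realization is an injective map $\varphi:V(\tau)\to[n]$; $\mathcal I$ is the set of tuples of distinct elements of $[n]$ (including the empty tuple); the graph matrix $\mathbf M_\tau\in\mathbb R^{\mathcal I\times\mathcal I}$ has $\mathbf M_\tau[I,J]=\sum_\varphi\prod_{\{u,v\}\in E(\tau)}G_{\varphi(u),\varphi(v)}$ over realizations with $\varphi(U_\tau)=I$, $\varphi(V_\tau)=J$ as ordered tuples. A vertex separator of $\tau$ is $S\subseteq V(\tau)$ such that after deleting $S$ and its incident edges there is no path from a vertex of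 $U_\tau$ to a vertex of $V_\tau$. For $S\subseteq V(\tau)$, $E(S)$ is the set of edges of $\tau$ with both endpoints in $S$. $I_\tau$ is the set of degree-$0$ vertices of $\tau$ in $V(\tau)\setminus(U_\tau\cup V_\tau)$. $\|\mathbf M\|_{2t}^{2t}=\operatorname{tr}((\mathbf M\mathbf M^\intercal)^t)$. *)

(* Defs.v *)
From Stdlib Require Import Reals.
From HB Require Import structures.
From mathcomp Require Import all_boot all_order all_algebra.
From mathcomp Require Import Rstruct.

Set Implicit Arguments.
Unset Strict Implicit.
Unset Printing Implicit Defensive.
Import Order.TTheory GRing.Theory Num.Theory.
Local Open Scope ring_scope.

(* A tuple of distinct elements of [n] = 'I_n has length k <= n. *)
Definition Idx (n : nat) :=
  {x : {k : 'I_n.+1 & k.-tuple 'I_n} | uniq (tagged x)}.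
Definition idx_seq (n : nat) (I : Idx n) : seq 'I_n := tagged (val I).

Definition pair2 (n : nat) := {e : {set 'I_n} | #|e| == 2}.
(* an outcome: for each pair, whether the "probability p" value was drawn *)
Definition outcome (n : nat) := {ffun pair2 n -> bool}.

Definition prob (p : R) (n : nat) (w : outcome n) : R :=
  \prod_(e : pair2 n) (if w e then p else 1 - p).

Definition Gval (p : R) (n : nat) (w : outcome n) (f : {set 'I_n}) : R :=
  match (insub f : option (pair2 n)) with
  | Some e => if w e then - Num.sqrt ((1 - p) / p) else Num.sqrt (p / (1 - p))
  | None => 0
  end.

Definition expect (p : R) (n : nat) (X : outcome n -> R) : R :=
  \sum_(w : outcome n) prob p w * X w.

(* A shape tau with vertex set 'I_m, edge set E (2-element subsets of 'I_m),
   and ordered subsets U, V (duplicate-free sequences of vertices).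
   M_tau[I,J] = sum over injective phi : V(tau) -> [n] with phi(U) = I and
   phi(V) = J (as ordered tuples) of prod_{{u,v} in E} G_{phi u, phi v}. *)
Definition graph_matrix (p : R) (n m : nat) (E : {set {set 'I_m}})
    (U V : seq 'I_m) (w : outcome n) (I J : Idx n) : R :=
  \sum_(phi : {ffun 'I_m -> 'I_n} |
          [&& injectiveb phi, map phi U == idx_seq I & map phi V == idx_seq J])
     \prod_(e in E) Gval p w (phi @: e).

Definition fmat (n : nat) := Idx n -> Idx n -> R.
Definition fmul (n : nat) (A B : fmat n) : fmat n :=
  fun I J => \sum_(K : Idx n) A I K * B K J.
Definition ftrans (n : nat) (A : fmat n) : fmat n := fun I J => A J I.
Definition fid (n : nat) : fmat n := fun I J => (I == J)%:R.
Definition ftr (n : nat) (A : fmat n) : R := \sum_(I : Idx n) A I I.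
(* ||A||_{2t}^{2t} = tr((A A^T)^t) *)
Definition schatten_pow (n : nat) (A : fmat n) (t : nat) : R :=
  ftr (iter t (fun X => fmul X (fmul A (ftrans A))) (@fid n)).

Definition avoid_rel (m : nat) (E : {set {set 'I_m}}) (S : {set 'I_m}) : rel 'I_m :=
  fun x y => [&& x \notin S, y \notin S & [set x; y] \in E].

Definition vertex_separator (m : nat) (E : {set {set 'I_m}}) (U V : seq 'I_m)
    (S : {set 'I_m}) : bool :=
  [forall u : 'I_m, forall v : 'I_m,
     [&& u \in U, v \in V, u \notin S & v \notin S] ==>
       ~~ connect (avoid_rel E S) u v].

Definition edges_in (m : nat) (E : {set {set 'I_m}}) (S : {set 'I_m}) :
  {set {set 'I_m}} := [set e in E | e \subset S].

Definition isolated_vertices (m : nat) (E : {set {set 'I_m}}) (U V : seq 'I_m) :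
  {set 'I_m} :=
  [set v : 'I_m | [&& v \notin U, v \notin V & [forall e in E, v \notin e]]].

(* Main.v *)
(** The trace method. The expected trace is a sum over closed walks of [2t]
    copies of the shape. A walk contributes only if every pair of [n] used by
    its edges is used at least twice, and then at most
    [sqrt ((1 - p) / p) ^ (2te - 2d)], where [e] is the number of edges of the
    shape and [d] the number of distinct pairs used. Walks are grouped by
    pattern: which edge slots land on the same pair, and with which
    orientation; there are at most [(16 t^2 e^2)^(te)] patterns.

    Within a pattern a walk is determined by its values on the set [F] of vertex
    slots that are not forced by an earlier copy, and also by its values on the
    set [L] of those not forced by a later copy, so the square of the number of
    walks is at most [n ^ (#|F| + #|L|)]. In a copy other than the first and the
    last one, the vertices forced in both directions form a separator; it
    contains both ends of every edge slot that is neither the first nor the last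
    use of its pair, and a vertex forced in neither direction is isolated. Hence
    the square of the contribution of a pattern is at most a product over the
    copies of factors from the maximum; the first and last copies account for
    the factor [n ^ m]. *)

Require Import Defs.
From Stdlib Require Import Reals.
From HB Require Import structures.
From mathcomp Require Import all_boot all_order all_algebra.
From mathcomp Require Import Rstruct zify.
Import Order.TTheory GRing.Theory Num.Theory.
Local Open Scope ring_scope.

Set Implicit Arguments.
Unset Strict Implicit.
Unset Printing Implicit Defensive.

(** * Moments of the biased edge variables *)

Section BiasedMoments.

Variables (p : R) (n : nat).
Hypotheses (p_gt0 : 0 < p) (p_le : p <= 2^-1).

Definition bias := Num.sqrt ((1 - p) / p).

Definition gvalue (b : bool) :=
  if b then - Num.sqrt ((1 - p) / p) else Num.sqrt (p / (1 - p)).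

Lemma p_lt1 : p < 1.
Proof. by apply: le_lt_trans p_le _; rewrite invf_lt1 ?ltr1n // ltr0n. Qed.

Lemma odds_ge1 : 1 <= (1 - p) / p.
Proof.
rewrite ler_pdivlMr // mul1r lerBrDr -mulr2n -mulr_natr.
by rewrite -ler_pdivlMr ?ltr0n // mul1r.
Qed.

Lemma bias_sqr : bias ^+ 2 = (1 - p) / p.
Proof. by rewrite sqr_sqrtr // (le_trans ler01) // odds_ge1. Qed.

Lemma bias_ge1 : 1 <= bias.
Proof. rewrite -[leLHS]sqrtr1; apply: ler_wsqrtr; exact: odds_ge1. Qed.

Lemma bias_gt0 : 0 < bias.
Proof. exact: lt_le_trans ltr01 bias_ge1. Qed.

Lemma gvalueE b : gvalue b = if b then - bias else bias^-1.
Proof. by rewrite /gvalue /bias -sqrtrV ?invf_div // (le_trans ler01) // odds_ge1. Qed.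

Lemma odds_mul : p * bias ^+ 2 = 1 - p.
Proof. by rewrite bias_sqr mulrC divfK ?gt_eqF. Qed.

Definition moment (k : nat) :=
  p * gvalue true ^+ k + (1 - p) * gvalue false ^+ k.

Lemma moment0 : moment 0 = 1.
Proof. by rewrite /moment !expr0 !mulr1 addrC subrK. Qed.

Lemma moment1 : moment 1 = 0.
Proof.
rewrite /moment !expr1 !gvalueE -odds_mul expr2 mulrN !mulrA mulfK ?addNr //.
exact: lt0r_neq0 bias_gt0.
Qed.

(** By [odds_mul] the weights trade places: in absolute value the two terms are [(1 - p) * bias ^ k]
    and [p * bias ^ (- k)], and [bias >= 1] bounds their sum. *)
Lemma norm_moment k : `|moment k.+2| <= bias ^+ k.
Proof.
have b0 := bias_gt0; have b1 := bias_ge1.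
have q0 : 0 <= 1 - p by rewrite subr_ge0 ltW // p_lt1.
rewrite /moment !gvalueE.
apply: le_trans (ler_normD _ _) _.
rewrite [X in X + _]normrM [X in _ + X]normrM !normrX normrN.
rewrite (ger0_norm (ltW p_gt0)) (ger0_norm q0).
rewrite !ger0_norm ?invr_ge0 ?(ltW b0) //.
have -> : p * bias ^+ k.+2 = (1 - p) * bias ^+ k.
  by rewrite -odds_mul -mulrA -exprD.
have -> : (1 - p) * bias^-1 ^+ k.+2 = p * bias^-1 ^+ k.
  rewrite -odds_mul -mulrA; congr (_ * _).
  by rewrite -[k.+2]addn2 exprD mulrCA -exprMn mulfV ?expr1n ?mulr1 // gt_eqF.
have : p * bias^-1 ^+ k <= p * bias ^+ k.
  apply: ler_wpM2l; first exact: ltW.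
  rewrite lerXn2r // ?nnegrE ?invr_ge0 ?(ltW b0) //.
  by rewrite (le_trans _ b1) // invf_le1.
move=> h; apply: le_trans (lerD (lexx _) h) _.
by rewrite -mulrDl subrK mul1r.
Qed.

Lemma Gval_pair (w : outcome n) (f : pair2 n) : Gval p w (val f) = gvalue (w f).
Proof. by rewrite /Gval valK. Qed.

(** Independence of the pairs: expanding the product of two-term sums enumerates the outcomes. *)
Lemma expect_prod (h : pair2 n -> bool -> R) :
  expect p (fun w : outcome n => \prod_f h f (w f))
  = \prod_f (p * h f true + (1 - p) * h f false).
Proof.
rewrite /expect /prob /=.
under [LHS]eq_bigr do rewrite -big_split /=.
under [RHS]eq_bigr => f _ do
  rewrite -[p * _ + _](big_bool _ (fun b => (if b then p else 1 - p) * h f b)).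
by rewrite bigA_distr_bigA.
Qed.

Lemma expect_Gval_monomial (T : finType) (edge : T -> {set 'I_n}) :
  (forall s, #|edge s| = 2%N) ->
  expect p (fun w : outcome n => \prod_s Gval p w (edge s))
  = \prod_(f : pair2 n) moment #|[set s | edge s == val f]|.
Proof.
move=> card_edge.
have ce s : #|edge s| == 2 by rewrite card_edge.
pose pe s : pair2 n := Sub (edge s) (ce s).
have peK s : val (pe s) = edge s by [].
rewrite /moment -(expect_prod (fun f b => gvalue b ^+ #|[set s | edge s == val f]|)).
apply: eq_bigr => w _; congr (_ * _).
rewrite (partition_big pe xpredT) //=; apply: eq_bigr => f _.
rewrite -prodr_const; apply: eq_big => s.
  by rewrite inE -(inj_eq val_inj) peK.
by move=> /eqP <-; rewrite -Gval_pair peK.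
Qed.

(** A pair used once contributes [moment 1 = 0]; one used [k >= 2] times contributes at most
    [bias ^ (k - 2)]. These exponents add up to [#|T|] minus twice the number of pairs. *)
Lemma norm_expect_Gval_monomial (T : finType) (edge : T -> {set 'I_n}) :
  (forall s, #|edge s| = 2%N) ->
  `|expect p (fun w : outcome n => \prod_s Gval p w (edge s))|
  <= if [forall s, exists s', (s' != s) && (edge s' == edge s)]
     then bias ^+ (#|T| - 2 * #|[set edge s | s : T]|) else 0.
Proof.
move=> card_edge; rewrite (expect_Gval_monomial card_edge).
have ce s : #|edge s| == 2 by rewrite card_edge.
pose pe s : pair2 n := Sub (edge s) (ce s).
have peK s : val (pe s) = edge s by [].
set k := fun f : pair2 n => #|[set s | edge s == val f]|.
case: ifPn => [/forallP cov | /forallPn[s /existsPn s_single]]; last first.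
  rewrite (bigD1 (pe s)) //= (_ : #|_| = 1%N) ?moment1 ?mul0r ?normr0 //.
  apply/eqP/cards1P; exists s; apply/setP=> s'; rewrite !inE ?peK.
  apply/idP/eqP => [e|-> //]; move: (s_single s').
  by rewrite e andbT negbK => /eqP.
have kgt1 s : (1 < k (pe s))%N.
  have /existsP[s' /andP[s's es']] := cov s.
  have <- : #|[set s'; s]| = 2%N by rewrite cards2 s's.
  by apply/subset_leq_card/subsetP => x; rewrite !inE peK => /orP[] /eqP->.
rewrite normr_prod.
pose D := [set pe s | s : T].
apply: (@le_trans _ _ (\prod_(f in D) bias ^+ (k f - 2))).
  rewrite [leRHS]big_mkcond /=; apply: ler_prod => f _; rewrite normr_ge0 /=.
  case: ifPn => [/imsetP[s _ ->]|fD].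
    by rewrite -/(k _); case: (k _) (kgt1 s) => [|[|j]] // _; rewrite subn2 norm_moment.
  rewrite (_ : #|_| = 0%N) ?moment0 ?normr1 //.
  apply: eq_card0 => s; rewrite !inE; apply/negP => /eqP es.
  by case/imsetP: fD; exists s => //; apply: val_inj; rewrite peK.
rewrite prodrXr ler_weXn2l ?bias_ge1 // sumnB; last by move=> f /imsetP[s _ ->].
rewrite sum_nat_const.
have -> : [set edge s | s : T] = [set val f | f in D].
  by rewrite -imset_comp; apply: eq_imset => s.
rewrite (card_imset _ val_inj) mulnC leq_sub2r //.
rewrite -sum1_card (partition_big pe (mem D)); last by move=> s _; apply: imset_f.
apply: leq_sum => f _; rewrite sum1dep_card; exact: subset_leq_card.
Qed.

End BiasedMoments.

(** * Patterns of walks *)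

Section Patterns.

Variables (n m : nat) (Cp Ed : finType) (ends : Ed -> 'I_m * 'I_m).
Variable link : Cp -> Cp -> pred 'I_m.

Local Notation embs := {ffun Cp -> {ffun 'I_m -> 'I_n}}.
Local Notation slot := (Cp * Ed)%type.

Definition end_set (e : Ed) : {set 'I_m} := [set (ends e).1; (ends e).2].

Definition slot_edge (x : embs) (s : slot) : {set 'I_n} := x s.1 @: end_set s.2.

Definition slot_bit (x : embs) (s : slot) : bool :=
  (x s.1 (ends s.2).1 < x s.1 (ends s.2).2)%N.

(** The choice depends only on the pair, so it is a canonical representative; the default is never
    reached, since [s] itself qualifies. *)
Definition slot_rep (x : embs) (s : slot) : slot :=
  odflt s [pick s' | slot_edge x s' == slot_edge x s].

Definition pattern (x : embs) : {ffun slot -> slot * bool} :=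
  [ffun s => (slot_rep x s, slot_bit x s)].

(** For an injective copy, the end receiving the smaller value if [lo] holds, the larger one
    otherwise. *)
Definition slot_end (lo : bool) (x : embs) (s : slot) : 'I_m :=
  if slot_bit x s == lo then (ends s.2).1 else (ends s.2).2.

Definition consistent (x : embs) : bool :=
  [forall c, forall c', forall v, link c c' v ==> (x c v == x c' v)].

(** The order [pos] is a parameter so that one definition serves for reading the walk forwards and
    backwards. *)
Definition forced (pos : Cp -> nat) (x : embs) : {set Cp * 'I_m} :=
  [set cv : Cp * 'I_m | [exists c', (pos c' < pos cv.1)%N &&
    (link cv.1 c' cv.2 || [exists e, exists e', (cv.2 \in end_set e) &&
       (slot_edge x (cv.1, e) == slot_edge x (c', e'))])]].

Lemma slot_edgeE x s :
  slot_edge x s = [set x s.1 (ends s.2).1; x s.1 (ends s.2).2].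
Proof. by rewrite /slot_edge /end_set imsetU1 imset_set1. Qed.

Lemma slot_edge_rep x s : slot_edge x (slot_rep x s) = slot_edge x s.
Proof. by rewrite /slot_rep; case: pickP => [s' /eqP|]. Qed.

Lemma slot_rep_eq x s s' :
  (slot_rep x s == slot_rep x s') = (slot_edge x s == slot_edge x s').
Proof.
apply/eqP/eqP => e; first by rewrite -(slot_edge_rep x s) e slot_edge_rep.
rewrite /slot_rep (@eq_pick _ _ (fun s1 => slot_edge x s1 == slot_edge x s')).
  by case: pickP => // /(_ s'); rewrite eqxx.
by move=> s1; rewrite e.
Qed.

(** Representatives correspond to pairs one to one, so the exponent of the moment bound depends on
    the pattern only. *)
Lemma card_slot_edges x :
  #|[set slot_edge x s | s : slot]| = #|[set (pattern x s).1 | s : slot]|.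
Proof.
rewrite (eq_imset (g := slot_rep x)) => [|s]; last by rewrite ffunE.
rewrite -(@card_in_imset _ _ (slot_edge x) (slot_rep x @: _)).
  by rewrite -imset_comp; congr #|pred_of_set _|; apply: eq_imset => s /=; rewrite slot_edge_rep.
move=> _ _ /imsetP[s _ ->] /imsetP[s' _ ->].
by rewrite !slot_edge_rep => /eqP; rewrite -slot_rep_eq => /eqP.
Qed.

Lemma pattern_edge x y s s' : pattern x = pattern y ->
  (slot_edge x s == slot_edge x s') = (slot_edge y s == slot_edge y s').
Proof.
move=> e; rewrite -!slot_rep_eq.
by have := congr1 (fun f : {ffun slot -> slot * bool} => ((f s).1, (f s').1)) e;
  rewrite !ffunE => -[-> ->].
Qed.

Lemma pattern_end lo x y s : pattern x = pattern y ->
  slot_end lo x s = slot_end lo y s.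
Proof.
by move=> e; have := congr1 (fun f : {ffun slot -> slot * bool} => (f s).2) e;
  rewrite !ffunE /slot_end => /= ->.
Qed.

Lemma set2_lt_eq (a b c d : 'I_n) (lo : bool) : [set a; b] = [set c; d] ->
  (if (a < b)%N == lo then a else b) = (if (c < d)%N == lo then c else d).
Proof.
move=> /setP e.
have := e a; have := e b; have := e c; have := e d.
rewrite !inE !eqxx ?orbT /=.
move=> /orP[]/eqP-> /orP[]/eqP-> // => [||].
- by move=> /esym/orP[]/eqP-> _; rewrite !if_same.
- by move=> _ _; case: lo; case: ltngtP => // /val_inj ->.
- by move=> _ /esym/orP[]/eqP->; rewrite !if_same.
Qed.

Lemma slot_edge_end lo x s s' : slot_edge x s = slot_edge x s' ->
  x s.1 (slot_end lo x s) = x s'.1 (slot_end lo x s').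
Proof.
rewrite !slot_edgeE => /(set2_lt_eq lo); rewrite /slot_end /slot_bit.
by case: ifP; case: ifP.
Qed.

Lemma mem_end_set x s v : v \in end_set s.2 -> exists lo, v = slot_end lo x s.
Proof.
rewrite !inE /slot_end => /orP[]/eqP->.
  by exists (slot_bit x s); rewrite eqxx.
by exists (~~ slot_bit x s); case: slot_bit.
Qed.

(* Restricting to the unforced vertex slots is injective, by induction along [pos]. *)
Lemma card_pattern_class pos (A : {set embs}) x0 :
  (forall x, x \in A -> pattern x = pattern x0 /\ consistent x) ->
  (#|A| <= n ^ #|~: forced pos x0|)%N.
Proof.
move=> Ap.
pose T := {cv | cv \in ~: forced pos x0}.
pose restrict (x : embs) : {ffun T -> 'I_n} := [ffun z => x (val z).1 (val z).2].
have -> : (n ^ #|~: forced pos x0|)%N = #|{: {ffun T -> 'I_n}}|.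
  by rewrite card_ffun card_ord card_sig; congr (_ ^ _)%N; apply: eq_card.
apply: (@leq_card_in _ _ restrict A) => x y xA yA exy.
have [px cx] := Ap _ xA; have [py cy] := Ap _ yA.
suff agree k c v : (pos c < k)%N -> x c v = y c v.
  by apply/ffunP => c; apply/ffunP => v; apply: (agree (pos c).+1).
elim: k c v => // k IH c v; rewrite ltnS => ck.
have [cv_forced|cv_free] := boolP ((c, v) \in forced pos x0); last first.
  have cvC : (c, v) \in ~: forced pos x0 by rewrite inE.
  by have := congr1 (fun f : {ffun T -> 'I_n} => f (Sub (c, v) cvC)) exy; rewrite !ffunE.
move: cv_forced; rewrite inE => /existsP[c' /andP[/= lt_c'c /orP[lk|]]].
  move/forallP/(_ c)/forallP/(_ c')/forallP/(_ v)/implyP/(_ lk)/eqP: cx => ->.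
  move/forallP/(_ c)/forallP/(_ c')/forallP/(_ v)/implyP/(_ lk)/eqP: cy => ->.
  exact/IH/(leq_trans lt_c'c ck).
case/existsP=> e1 /existsP[e2 /andP[ve1 ed]].
have [lo ->] := @mem_end_set x0 (c, e1) v ve1.
have ex : slot_edge x (c, e1) = slot_edge x (c', e2).
  by apply/eqP; rewrite (pattern_edge _ _ px).
have ey : slot_edge y (c, e1) = slot_edge y (c', e2).
  by apply/eqP; rewrite (pattern_edge _ _ py).
(* The value at [v] is also taken at the matching end of the slot in [c']. The pattern fixes that
   end, so [x] and [y] are compared at the same vertex of an earlier copy. *)
have := slot_edge_end lo ex; have := slot_edge_end lo ey.
rewrite !(pattern_end _ _ px) !(pattern_end _ _ py) /= => -> ->.
exact/IH/(leq_trans lt_c'c ck).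
Qed.

Lemma card_pair_set (T : finType) (A : {set Cp * T}) :
  #|A| = (\sum_c #|[set v | (c, v) \in A]|)%N.
Proof.
rewrite -sum1_card (eq_bigl (fun cv => true && ((cv.1, cv.2) \in A))); last by case.
rewrite -(pair_big_dep xpredT (fun c v => (c, v) \in A) (fun _ _ => 1%N)) /=.
by apply: eq_bigr => c _; rewrite sum1dep_card.
Qed.

Hypothesis end_set_inj : injective end_set.

Lemma slot_edge_inj (x : embs) c : injective (x c) -> injective (fun e => slot_edge x (c, e)).
Proof. by move=> xc e e' /(imset_inj xc)/end_set_inj. Qed.

Definition initial (pos : Cp -> nat) (x : embs) : {set slot} :=
  [set s | [forall s', (slot_edge x s' == slot_edge x s) ==> (pos s.1 <= pos s'.1)%N]].

(** Two earliest slots of one pair lie in the same copy, as [pos] is injective; there distinct edges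
    have distinct pairs. *)
Lemma card_initial (pos : Cp -> nat) (x : embs) : injective pos -> (forall c, injective (x c)) ->
  (#|initial pos x| <= #|[set slot_edge x s | s : slot]|)%N.
Proof.
move=> pos_inj x_inj; rewrite -(@card_in_imset _ _ (slot_edge x)).
  by apply/subset_leq_card/subsetP => _ /imsetP[s _ ->]; apply: imset_f.
move=> [c e] [c' e']; rewrite !inE => /forallP h /forallP h' ee.
have cc : c = c'.
  apply/pos_inj/eqP; rewrite eqn_leq.
  by have := h (c', e'); have := h' (c, e); rewrite ee eqxx /= => -> ->.
by rewrite -cc in ee *; rewrite (slot_edge_inj (x_inj c) ee).
Qed.

Lemma forced_not_initial pos x c e v : (c, e) \notin initial pos x ->
  v \in end_set e -> (c, v) \in forced pos x.
Proof.
rewrite inE => /forallPn[[c' e']]; rewrite negb_imply -ltnNge /= => /andP[/eqP ed lt] ve.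
rewrite inE; apply/existsP; exists c'; rewrite lt /=; apply/orP; right.
by apply/existsP; exists e; apply/existsP; exists e'; rewrite ve ed /=.
Qed.

End Patterns.

(** * Separators in the copies of a walk *)

Lemma vertex_separatorC m (E : {set {set 'I_m}}) U V S :
  vertex_separator E U V S = vertex_separator E V U S.
Proof.
have sym : connect_sym (avoid_rel E S).
  by apply: sym_connect_sym => x y; rewrite /avoid_rel setUC; case: (_ \in S); case: (_ \in S).
apply/idP/idP => /forallP h; apply/forallP => u; apply/forallP => v;
  apply/implyP => /and4P[uU vV uS vS]; rewrite sym;
  by move: (h v) => /forallP/(_ u)/implyP; apply; rewrite vV uU uS vS.
Qed.

(* Outside the separator every vertex lies in exactly one of [F] and [L], and
   no edge leads from [L :\: F] to [F :\: L]. *)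
Lemma separator_of_cover m (E : {set {set 'I_m}}) (U V : seq 'I_m) (F L : {set 'I_m}) :
  (forall a b, [set a; b] \in E ->
     (a \notin F) && (b \notin F) || (a \notin L) && (b \notin L)) ->
  (forall u, u \in U -> u \notin F) -> (forall v, v \in V -> v \notin L) ->
  vertex_separator E U V (~: (F :|: L)).
Proof.
move=> edgeE UF VL; set S := ~: _.
apply/forallP => u; apply/forallP => v; apply/implyP => /and4P[uU vV uS vS].
have cl : closed (avoid_rel E S) (mem L).
  move=> a b; rewrite /avoid_rel !inE !negbK => /and3P[].
  by move=> aFL bFL /edgeE; move: aFL bFL; do 4!case: (_ \in _).
apply/negP => uv; have : (u \in L) = (v \in L) by exact: (closed_connect cl uv).
by move: uS; rewrite (negbTE (VL _ vV)); rewrite !inE negbK (negbTE (UF _ uU)) /= => ->.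
Qed.

Section Walks.

Variables (n m t : nat) (Ed : finType) (ends : Ed -> 'I_m * 'I_m).
Variables U V : seq 'I_m.

(* The factors of the trace of (M M^T)^t in cyclic order:
   (i, false) is the i-th factor M and (i, true) the i-th factor M^T. *)
Definition copy : predArgType := ('I_t * bool)%type.

Definition cpos (c : copy) : nat := (c.2 + c.1.*2)%N.
Definition rpos (c : copy) : nat := (t.*2 - cpos c)%N.
(** In the trace the factors are [M[K_i, L_i]] and [M[K_(i+1), L_i]], cyclically in [i]. This is the
    subscript of [K]; that of [L] is [c.1]. *)
Definition row_index (c : copy) : 'I_t := if c.2 then ordS c.1 else c.1.
Definition blink (c c' : copy) : pred 'I_m :=
  fun v => (v \in U) && (row_index c == row_index c') || (v \in V) && (c.1 == c'.1).

Lemma cpos_inj : injective cpos.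
Proof.
move=> [i b] [j b']; rewrite /cpos /= => e.
have eb : b = b' by have := congr1 odd e; rewrite !oddD !odd_double !addbF !oddb.
have := congr1 half e; rewrite !half_bit_double => /val_inj ->.
by rewrite eb.
Qed.

Lemma cpos_lt c : (cpos c < t.*2)%N.
Proof. by case: c => i b; rewrite /cpos /=; have := ltn_ord i; case: b => /=; lia. Qed.

Lemma rpos_lt c c' : (rpos c' < rpos c)%N = (cpos c < cpos c')%N.
Proof. by rewrite /rpos; have := cpos_lt c; have := cpos_lt c'; lia. Qed.

Lemma rpos_inj : injective rpos.
Proof.
move=> c c' e; apply: cpos_inj; apply/eqP; rewrite eqn_leq.
by rewrite ![(cpos _ <= _)%N]leqNgt -!rpos_lt e ltnn.
Qed.

Definition inner (c : copy) : bool := (0 < cpos c < (t.*2).-1)%N.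

Lemma card_outer : (#|[set c | ~~ inner c]| <= 2)%N.
Proof.
(* Only the positions [0] and [2t - 1] are outer, and testing for [0] tells them apart. *)
rewrite -card_bool; apply: (@leq_card_in _ _ (fun c => cpos c == 0)).
move=> c c'; rewrite !inE /inner => h h' e; apply: cpos_inj.
by move: h h' e; have := cpos_lt c; have := cpos_lt c'; lia.
Qed.

Local Notation embs := {ffun copy -> {ffun 'I_m -> 'I_n}}.
Local Notation forced pos x := (forced ends blink pos x).

Lemma forced_either (x : embs) c c' v : c' != c ->
  blink c c' v || [exists e, exists e', (v \in end_set ends e) &&
       (slot_edge ends x (c, e) == slot_edge ends x (c', e'))] ->
  ((c, v) \in forced cpos x) || ((c, v) \in forced rpos x).
Proof.
move=> nc h; have : cpos c' != cpos c by rewrite (inj_eq cpos_inj).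
rewrite neq_ltn => /orP[lt|lt]; apply/orP; [left|right]; rewrite inE.
  by apply/existsP; exists c'; rewrite lt.
by apply/existsP; exists c'; rewrite rpos_lt lt.
Qed.

Lemma forced_cpos_U (x : embs) c c' v : v \in U -> row_index c = row_index c' ->
  (cpos c' < cpos c)%N -> (c, v) \in forced cpos x.
Proof.
by move=> vU e lt; rewrite inE; apply/existsP; exists c'; rewrite lt /blink vU e eqxx.
Qed.

Lemma forced_cpos_V (x : embs) c c' v : v \in V -> c.1 = c'.1 ->
  (cpos c' < cpos c)%N -> (c, v) \in forced cpos x.
Proof.
by move=> vV e lt; rewrite inE; apply/existsP; exists c'; rewrite lt /blink vV e eqxx orbT.
Qed.

Lemma forced_rpos_U (x : embs) c c' v : v \in U -> row_index c = row_index c' ->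
  (cpos c < cpos c')%N -> (c, v) \in forced rpos x.
Proof.
by move=> vU e lt; rewrite inE; apply/existsP; exists c'; rewrite rpos_lt lt /blink vU e eqxx.
Qed.

Lemma forced_rpos_V (x : embs) c c' v : v \in V -> c.1 = c'.1 ->
  (cpos c < cpos c')%N -> (c, v) \in forced rpos x.
Proof.
by move=> vV e lt; rewrite inE; apply/existsP; exists c'; rewrite rpos_lt lt /blink vV e eqxx orbT.
Qed.

(** An inner copy [(i, false)] shares its row tuple with the earlier [(i - 1, true)] and its column
    tuple with the later [(i, true)]. An inner [(i, true)] shares columns with the earlier
    [(i, false)] and rows with the later [(i + 1, false)]. Being inner excludes wrapping around the
    cycle. *)
Lemma inner_forced (x : embs) c : inner c ->
  (forall v, v \in U -> (c, v) \in forced cpos x)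
    /\ (forall v, v \in V -> (c, v) \in forced rpos x)
  \/ (forall v, v \in V -> (c, v) \in forced cpos x)
    /\ (forall v, v \in U -> (c, v) \in forced rpos x).
Proof.
case: c => i [] inn; [right|left]; split=> v vUV.
- by apply: (@forced_cpos_V _ _ (i, false)); rewrite // /cpos /=.
- have it : (i.+1 < t)%N by move: inn; rewrite /inner /cpos /=; lia.
  apply: (@forced_rpos_U _ _ (Ordinal it, false)); rewrite // /cpos /=.
  by apply: val_inj; rewrite /= modn_small.
- have it : (i.-1 < t)%N by have := ltn_ord i; lia.
  have i0 : (0 < i)%N by move: inn; rewrite /inner /cpos /=; lia.
  apply: (@forced_cpos_U _ _ (Ordinal it, true)); rewrite // /cpos /=; last by lia.
  by apply: val_inj; rewrite /= prednK // modn_small.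
- by apply: (@forced_rpos_V _ _ (i, true)); rewrite // /cpos /=.
Qed.

Hypothesis end_set_inj : injective (end_set ends).

Variable x : embs.
Hypothesis x_inj : forall c, injective (x c).
Hypothesis x_cover : forall s, exists2 s', s' != s & slot_edge ends x s' = slot_edge ends x s.

Let E : {set {set 'I_m}} := [set end_set ends e | e : Ed].
Let F (c : copy) : {set 'I_m} := [set v | (c, v) \in ~: forced cpos x].
Let L (c : copy) : {set 'I_m} := [set v | (c, v) \in ~: forced rpos x].

Lemma cover_other_copy c e : exists c' e', c' != c /\
  slot_edge ends x (c, e) = slot_edge ends x (c', e').
Proof.
have [[c' e'] ne ed] := x_cover (c, e); exists c', e'; split=> //.
apply: contraNneq ne => cc; rewrite cc in ed *.
by rewrite (slot_edge_inj end_set_inj (@x_inj c) ed).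
Qed.

(** A vertex of [U], of [V] or of an edge is tied to some other copy. That copy is earlier or later,
    so one direction forces the vertex; wrapping around does no harm here. *)
Lemma unforced_isolated c : F c :&: L c \subset isolated_vertices E U V.
Proof.
apply/subsetP => v; rewrite !inE /= => /andP[].
move=> nF nL; have nFL : ~ ((c, v) \in forced cpos x) || ((c, v) \in forced rpos x).
  by rewrite !inE (negbTE nF) (negbTE nL).
apply/and3P; split; [apply/negP => vUV; apply: nFL | apply/negP => vUV; apply: nFL | ].
- have [c' nc ec] : exists2 c', c' != c & row_index c = row_index c'.
    case: (c) => i []; last first.
      exists (ord_pred i, true); first by rewrite xpair_eqE andbF.
      by rewrite /row_index /= ord_predK.
    by exists (ordS i, false); first by rewrite xpair_eqE andbF.
  by apply: (forced_either nc); rewrite /blink vUV ec eqxx.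
- apply: (@forced_either _ _ (c.1, ~~ c.2)); last by rewrite /blink vUV eqxx orbT.
  by case: (c) => i []; rewrite xpair_eqE andbF.
- apply/forallP => e'; apply/implyP => /imsetP[e _ ->]; apply/negP => ve; apply: nFL.
  have [c' [e'' [nc ed]]] := cover_other_copy c e.
  apply: (forced_either nc); apply/orP; right.
  by apply/existsP; exists e; apply/existsP; exists e''; rewrite ve ed /=.
Qed.

(** Another copy uses the same pair; if earlier it keeps both ends out of [F c], if later out of
    [L c]. *)
Lemma cover_edge_side c a b : [set a; b] \in E ->
  (a \notin F c) && (b \notin F c) || (a \notin L c) && (b \notin L c).
Proof.
case/imsetP => e _ abe.
have [ae be] : a \in end_set ends e /\ b \in end_set ends e by rewrite -abe !inE !eqxx orbT.
have [c' [e' [nc ed]]] := cover_other_copy c e.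
have : cpos c' != cpos c by rewrite (inj_eq cpos_inj).
have forcedP (pos : copy -> nat) : (pos c' < pos c)%N ->
    forall v, v \in end_set ends e -> (c, v) \in forced pos x.
  move=> lt v ve; rewrite inE; apply/existsP; exists c'; rewrite lt /=; apply/orP; right.
  by apply/existsP; exists e; apply/existsP; exists e'; rewrite ve ed /=.
have mF v : (v \in F c) = ((c, v) \notin forced cpos x) by rewrite 2!inE.
have mL v : (v \in L c) = ((c, v) \notin forced rpos x) by rewrite 2!inE.
rewrite neq_ltn !mF !mL !negbK => /orP[/forcedP h|].
  by rewrite !h.
by rewrite -rpos_lt => /forcedP h; rewrite !h ?orbT.
Qed.

(* In the first (last) copy nothing is forced by an earlier (later) one, so the
   doubly forced vertices do not separate there. *)
Let sep (c : copy) : {set 'I_m} := if inner c then ~: (F c :|: L c) else setT.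

Lemma sep_separator c : vertex_separator E U V (sep c).
Proof.
rewrite /sep; case: ifP => [inn|_]; last first.
  by apply/forallP => u; apply/forallP => v; rewrite !inE !andbF.
have [[hU hV]|[hV hU]] := inner_forced x inn.
  apply: separator_of_cover; first exact: cover_edge_side.
    by move=> u /hU h; rewrite 2!inE h.
  by move=> v /hV h; rewrite 2!inE h.
(* In a transposed copy [V] is forced from before and [U] from after, so the two sides are
   exchanged. *)
rewrite vertex_separatorC; apply: separator_of_cover; first exact: cover_edge_side.
  by move=> u /hV h; rewrite 2!inE h.
by move=> v /hU h; rewrite 2!inE h.
Qed.

(** The left side is [#|F c :|: L c| + #|F c :&: L c|], and the intersection is isolated. In an
    inner copy the union is the complement of [sep c]; in an outer one [m - #|sep c|] is [0] and the
    extra [m] pays for the union. *)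
Lemma card_unforced c :
  (#|F c| + #|L c| <= (if inner c then 0 else m)
     + (m - #|sep c| + #|isolated_vertices E U V|))%N.
Proof.
have := subset_leq_card (unforced_isolated c); rewrite -cardsUI.
have := cardsC (F c :|: L c); rewrite card_ord /sep.
have arith (a b i j k : nat) :
  (a + b = k -> i <= j -> (a + i <= k - b + j) && (a + i <= k + j))%N by lia.
by case: ifP => _; rewrite ?cardsT ?card_ord ?subnn ?add0n => eFL le_iso;
  case/andP: (arith _ _ _ _ _ eFL le_iso).
Qed.

Lemma sum_unforced :
  (#|~: forced cpos x| + #|~: forced rpos x| <=
   2 * m + \sum_c (m - #|sep c| + #|isolated_vertices E U V|))%N.
Proof.
rewrite !card_pair_set -big_split /=.
apply: leq_trans (leq_sum _ (fun c _ => card_unforced c)) _.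
rewrite big_split /= leq_add2r.
under eq_bigr do rewrite -if_neg.
by rewrite -big_mkcond /= sum_nat_cond_const leq_mul2r card_outer orbT.
Qed.

(** There are at most as many first uses as pairs, and likewise last uses, so the left side bounds
    from below the number of slots that are neither. Both ends of such a slot are forced in both
    directions, hence lie in [sep c]. *)
Lemma sum_edges_in :
  (#|{: copy * Ed}| - 2 * #|[set slot_edge ends x s | s : copy * Ed]|
   <= \sum_c #|edges_in E (sep c)|)%N.
Proof.
have cF := card_initial end_set_inj cpos_inj x_inj.
have cL := card_initial end_set_inj rpos_inj x_inj.
set I := initial ends cpos x in cF; set J := initial ends rpos x in cL.
apply: (@leq_trans #|~: (I :|: J)|).
  have arith (a b d u i v N : nat) :
    (a <= d -> b <= d -> u + v = N -> u + i = a + b -> N - 2 * d <= v)%N by lia.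
  exact: arith cF cL (cardsC (I :|: J)) (cardsUI I J).
rewrite card_pair_set; apply: leq_sum => c _.
rewrite -(card_imset _ end_set_inj); apply/subset_leq_card/subsetP => _ /imsetP[e eIJ ->].
rewrite inE imset_f //=; move: eIJ; rewrite in_set in_setC in_setU negb_or => /andP[eI eJ].
rewrite /sep; case: ifP => // _; apply/subsetP => v ve.
rewrite in_setC in_setU; apply/norP; split; rewrite in_set in_setC negbK.
  exact: forced_not_initial eI ve.
exact: forced_not_initial eJ ve.
Qed.

End Walks.

(** * Expansion of the trace *)

Section TraceExpansion.

Lemma idx_seq_inj n : injective (@idx_seq n).
Proof.
move=> [[k u] hu] [[k' u'] hu'] /= e.
have ek : k = k'.
  by apply: val_inj; rewrite /= -[LHS](size_tuple u) -[RHS](size_tuple u'); congr size.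
case: _ / ek in u' hu' e *.
by apply: val_inj => /=; congr existT; apply: val_inj.
Qed.

Lemma iter_fmul_path n (B : fmat n) s I J :
  iter s.+1 (fun X => fmul X B) (@fid n) I J
  = \sum_(K : {ffun 'I_s.+1 -> Idx n} | K ord0 == I)
      (\prod_(i < s) B (K (widen_ord (leqnSn s) i)) (K (lift ord0 i))) * B (K ord_max) J.
Proof.
elim: s J => [|s IH] J.
  rewrite (big_pred1 [ffun=> I]) => [|K]; last first.
    apply/eqP/eqP => [KI|->]; last by rewrite ffunE.
    by apply/ffunP => i; rewrite ffunE (ord1 i).
  rewrite big_ord0 mul1r ffunE /= /fmul /fid (bigD1 I) //= eqxx mul1r.
  by rewrite big1 ?addr0 // => K KI; rewrite eq_sym (negbTE KI) mul0r.
rewrite iterS /fmul.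
under eq_bigr do rewrite IH mulr_suml.
rewrite exchange_big pair_big /=.
(* [h] appends a last index to a path. *)
pose h (u : {ffun 'I_s.+1 -> Idx n} * Idx n) : {ffun 'I_s.+2 -> Idx n} :=
  [ffun i => if unlift ord_max i is Some j then u.1 j else u.2].
have hlift u j : h u (lift ord_max j) = u.1 j by rewrite ffunE liftK.
have hmax u : h u ord_max = u.2 by rewrite ffunE unlift_none.
have hE u (i : 'I_s.+2) (j : 'I_s.+1) : val i = val j -> h u i = u.1 j.
  by move=> e; rewrite -hlift; congr (h u _); apply: val_inj; rewrite e; exact/esym/lift_max.
have hbij : bijective h.
  exists (fun K : {ffun 'I_s.+2 -> Idx n} =>
    ([ffun j : 'I_s.+1 => K (lift ord_max j)] : {ffun 'I_s.+1 -> Idx n}, K ord_max)) => [[K K']|K].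
    by congr pair; rewrite ?hmax //; apply/ffunP => j; rewrite ffunE hlift.
  apply/ffunP => i; rewrite ffunE; case: unliftP => [j|] -> //=.
  by rewrite ffunE.
rewrite [RHS](reindex h) /=; last exact: onW_bij.
apply: eq_big => [u|u _]; first by rewrite (hE _ _ ord0) // andbT.
rewrite hmax big_ord_recr /=; congr (_ * _ * _); last first.
  by rewrite (hE _ _ ord_max) //; congr (B _ _); rewrite -(hmax u); congr (h u _); apply: val_inj.
apply: eq_bigr => i _; congr (B _ _); apply/esym/hE => //.
Qed.

Lemma schatten_walk n (A : fmat n) s :
  schatten_pow A s.+1
  = \sum_(KL : {ffun 'I_s.+1 -> Idx n} * {ffun 'I_s.+1 -> Idx n})
      \prod_(c : copy s.+1) A (KL.1 (row_index c)) (KL.2 c.1).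
Proof.
rewrite /schatten_pow /ftr.
under eq_bigr do rewrite iter_fmul_path.
rewrite (exchange_big_dep xpredT) //=.
rewrite -(pair_big xpredT xpredT 
  (fun K L : {ffun 'I_s.+1 -> Idx n} =>
     \prod_(c : copy s.+1) A (K (row_index c)) (L c.1))) /=.
apply: eq_bigr => K _.
rewrite (big_pred1 (K ord0)) => [|I]; last by rewrite eq_sym.
pose F i L := A (K i) L * A (K (ordS i)) L.
(* Each factor [A A^T] sums over one middle index, and [ordS] closes the walk at [K_0]. Distributing
   the product over these sums produces [L]. *)
transitivity (\prod_(i < s.+1) \sum_L F i L).
  rewrite big_ord_recr /=; congr (_ * _).
    apply: eq_bigr => i _; rewrite /fmul /Defs.ftrans /F; apply: eq_bigr => L _.
    congr (_ * A (K _) _); apply: val_inj; rewrite /= /bump modn_small //.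
    by rewrite ltnS.
  rewrite /fmul /Defs.ftrans /F; apply: eq_bigr => L _; congr (_ * A (K _) _).
  by apply: val_inj; rewrite /= modnn.
rewrite bigA_distr_bigA /=; apply: eq_bigr => L _.
rewrite -(pair_big xpredT xpredT (fun i b => A (K (row_index (i, b))) (L i))) /=.
by apply: eq_bigr => i _; rewrite big_bool /F /= mulrC.
Qed.

Lemma eq_schatten_pow n (A A' : fmat n) t : A =2 A' -> schatten_pow A t = schatten_pow A' t.
Proof.
move=> e; case: t => // s; rewrite !schatten_walk.
by apply: eq_bigr => KL _; apply: eq_bigr => c _.
Qed.

Lemma schatten_pow0 n t : (0 < t)%N -> schatten_pow (fun _ _ : Idx n => 0) t = 0.
Proof.
case: t => // s _; rewrite schatten_walk big1 // => KL _.
by rewrite (bigD1 (ord0, true)) //= mul0r.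
Qed.

Lemma expect_sum p n (T : finType) (P : pred T) (F : T -> outcome n -> R) :
  expect p (fun w => \sum_(i | P i) F i w) = \sum_(i | P i) expect p (F i).
Proof. by rewrite /expect exchange_big /=; apply: eq_bigr => w _; rewrite mulr_sumr. Qed.

Lemma expectZ p n (a : R) (F : outcome n -> R) :
  expect p (fun w => a * F w) = a * expect p F.
Proof. by rewrite /expect mulr_sumr; apply: eq_bigr => w _; rewrite mulrCA. Qed.

Lemma eq_expect p n (F G : outcome n -> R) : F =1 G -> expect p F = expect p G.
Proof. by move=> e; apply: eq_bigr => w _; rewrite e. Qed.

Lemma prod_natr_bool (T : finType) (b : pred T) :
  \prod_c ((b c)%:R : R) = [forall c, b c]%:R.
Proof.
case: forallP => [h|/forallP/forallPn[c nc]]; first by rewrite big1 // => c _; rewrite h.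
by rewrite (bigD1 c) //= (negbTE nc) mul0r.
Qed.

Variables (n m s : nat) (Ed : finType) (ends : Ed -> 'I_m * 'I_m) (U V : seq 'I_m).
Hypothesis end_set_inj : injective (end_set ends).

Let E : {set {set 'I_m}} := [set end_set ends e | e : Ed].
Local Notation copy := (copy s.+1).
Local Notation embs := {ffun copy -> {ffun 'I_m -> 'I_n}}.

Definition good (x : embs) : bool :=
  [forall c, injectiveb (x c)] && consistent (blink U V) x.

Definition boundary (phi : {ffun 'I_m -> 'I_n}) (I J : Idx n) : bool :=
  [&& injectiveb phi, map phi U == idx_seq I & map phi V == idx_seq J].

Lemma graph_matrixE p w I J : graph_matrix p E U V w I J
  = \sum_phi (boundary phi I J)%:R * \prod_e Gval p w (phi @: end_set ends e).
Proof.
rewrite /graph_matrix big_mkcond /=; apply: eq_bigr => phi _.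
rewrite -/(boundary phi I J); case: boundary; rewrite ?mul0r // mul1r.
by rewrite big_imset //=; move=> e e' _ _; apply: end_set_inj.
Qed.

(** A walk determines its index tuples: [K_i] and [L_i] are the images of [U] and [V] under the copy
    [(i, false)]. They exist only if copies sharing a tuple agree on it. *)
Lemma card_boundary (x : embs) :
  (#|[set KL : {ffun 'I_s.+1 -> Idx n} * {ffun 'I_s.+1 -> Idx n} |
      [forall c : copy, boundary (x c) (KL.1 (row_index c)) (KL.2 c.1)]]| <= good x)%N.
Proof.
set A := [set KL | _].
have [->|[KL0 KL0A]] := set_0Vmem A; first by rewrite cards0.
have AE KL c : KL \in A -> [/\ injective (x c),
    map (x c) U = idx_seq (KL.1 (row_index c)) & map (x c) V = idx_seq (KL.2 c.1)].
  by rewrite inE => /forallP/(_ c)/and3P[/injectiveP ? /eqP ? /eqP ?].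
have -> : good x.
  apply/andP; split; first by apply/forallP => c; apply/injectiveP; case: (AE _ c KL0A).
  apply/forallP => c; apply/forallP => c'; apply/forallP => v; apply/implyP.
  have [_ cU cV] := AE _ c KL0A; have [_ cU' cV'] := AE _ c' KL0A.
  case/orP=> /andP[vUV /eqP e]; apply/eqP.
    by move: cU; rewrite e -cU' => /eq_in_map/(_ v vUV).
  by move: cV; rewrite e -cV' => /eq_in_map/(_ v vUV).
apply/card_le1_eqP => -[K L] [K' L'] KLA KLA'.
congr pair; apply/ffunP => i; apply: idx_seq_inj.
  have [_ e _] := AE _ (i, false) KLA; have [_ e' _] := AE _ (i, false) KLA'.
  by rewrite /= in e e'; rewrite -e -e'.
have [_ _ e] := AE _ (i, false) KLA; have [_ _ e'] := AE _ (i, false) KLA'.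
by rewrite /= in e e'; rewrite -e -e'.
Qed.

Lemma expect_schatten_le p :
  expect p (fun w : outcome n => schatten_pow (graph_matrix p E U V w) s.+1)
  <= \sum_(x : embs | good x)
       `|expect p (fun w : outcome n => \prod_sl Gval p w (slot_edge ends x sl))|.
Proof.
pose X (x : embs) := expect p (fun w : outcome n => \prod_sl Gval p w (slot_edge ends x sl)).
pose b (x : embs) (KL : {ffun 'I_s.+1 -> Idx n} * {ffun 'I_s.+1 -> Idx n}) :=
  [forall c : copy, boundary (x c) (KL.1 (row_index c)) (KL.2 c.1)].
have -> : expect p (fun w : outcome n => schatten_pow (graph_matrix p E U V w) s.+1)
    = \sum_KL \sum_x (b x KL)%:R * X x.
  under eq_expect do rewrite schatten_walk.
  rewrite expect_sum; apply: eq_bigr => KL _.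
  under [RHS]eq_bigr do rewrite -expectZ.
  rewrite -expect_sum; apply: eq_expect => w.
  under eq_bigr do rewrite graph_matrixE.
  rewrite bigA_distr_bigA /=; apply: eq_bigr => x _.
  rewrite big_split /= prod_natr_bool; congr (_ * _).
  by rewrite (pair_bigA _ (fun c e => Gval p w (x c @: end_set ends e))).
rewrite exchange_big /= [leRHS]big_mkcond /=; apply: ler_sum => x _.
rewrite -mulr_suml -natr_sum -big_mkcond /= sum1dep_card.
have : (#|[set KL | b x KL]| <= good x)%N := card_boundary x.
move=> le_good; apply: (@le_trans _ _ (#|[set KL | b x KL]|%:R * `|X x|)).
  by rewrite ler_wpM2l ?ler0n ?ler_norm.
case: good le_good => [le1|]; last by rewrite leqn0 => /eqP->; rewrite mul0r.
by rewrite ler_piMl // (ler_nat _ _ 1).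
Qed.

End TraceExpansion.

(** * The contribution of a pattern *)

Section Assembly.

Variables (p : R) (n m s : nat) (Ed : finType) (ends : Ed -> 'I_m * 'I_m).
Variables U V : seq 'I_m.
Hypotheses (p_gt0 : 0 < p) (p_le : p <= 2^-1).
Hypothesis end_set_inj : injective (end_set ends).
Hypothesis card_end_set : forall e, #|end_set ends e| = 2%N.
Hypothesis Ed_gt0 : (0 < #|Ed|)%N.

Let E : {set {set 'I_m}} := [set end_set ends e | e : Ed].
Local Notation t := s.+1.
Local Notation copy := (copy t).
Local Notation embs := {ffun copy -> {ffun 'I_m -> 'I_n}}.
Local Notation slot := (copy * Ed)%type.
Local Notation q := ((1 - p) / p).
Local Notation Y := (\big[Num.max/0]_(S : {set 'I_m} | vertex_separator E U V S)
  (q ^+ (t * #|edges_in E S|) * n%:R ^+ (t * (m - #|S| + #|isolated_vertices E U V|)))).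

Definition covered (x : embs) : bool :=
  [forall sl, exists sl', (sl' != sl) && (slot_edge ends x sl' == slot_edge ends x sl)].

Definition excess (x : embs) : nat :=
  (#|{: slot}| - 2 * #|[set slot_edge ends x sl | sl : slot]|)%N.

Lemma excess_pattern x y : pattern ends x = pattern ends y -> excess x = excess y.
Proof. by move=> e; rewrite /excess !card_slot_edges e. Qed.

Lemma card_slot_edge (phi : {ffun 'I_m -> 'I_n}) e : injective phi ->
  #|phi @: end_set ends e| = 2%N.
Proof. by move=> phi_inj; rewrite card_imset // card_end_set. Qed.

(** An injective realization sends distinct edges to distinct pairs, so each monomial contains a
    pair used exactly once. *)
Lemma expect_graph_matrix I J : expect p (fun w : outcome n => graph_matrix p E U V w I J) = 0.
Proof.
under eq_expect do rewrite (graph_matrixE _ _ end_set_inj).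
rewrite expect_sum big1 // => phi _; rewrite expectZ.
rewrite /boundary; case: injectiveP => [phi_inj|_]; last by rewrite mul0r.
have := norm_expect_Gval_monomial p_gt0 p_le (fun e => card_slot_edge e phi_inj).
rewrite ifN ?normr_le0; first by move=> /eqP->; rewrite mulr0.
have [e0 _] := card_gt0P Ed_gt0.
apply/forallPn; exists e0; apply/existsPn => e.
by rewrite (inj_eq (inj_comp (imset_inj phi_inj) end_set_inj)) andNb.
Qed.

Lemma maxterm_ge0 : 0 <= Y.
Proof. exact: bigmax_ge_id. Qed.

(** After raising to the power [t], the right side is one factor [Y] for each of the [2t] copies,
    and the contribution of each copy on the left is a term of the maximum. *)
Lemma prod_separators (S : copy -> {set 'I_m}) :
  (forall c, vertex_separator E U V (S c)) ->
  n%:R ^+ (\sum_c (m - #|S c| + #|isolated_vertices E U V|))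
    * q ^+ (\sum_c #|edges_in E (S c)|) <= Y ^+ 2.
Proof.
have q_ge0 : 0 <= q by rewrite (le_trans ler01) // odds_ge1.
move=> sepS; rewrite -(@ler_pXn2r _ t) ?nnegrE //; last 2 first.
- by rewrite mulr_ge0 ?exprn_ge0 ?ler0n.
- by rewrite exprn_ge0 // maxterm_ge0.
rewrite -[leRHS]exprM exprMn.
have -> : (2 * t)%N = #|{: copy}| by rewrite card_prod card_ord card_bool mulnC.
rewrite -prodr_const -2!prodrXr -!prodrXl -big_split /=.
apply: ler_prod => c _; rewrite -!exprM mulr_ge0 ?exprn_ge0 ?ler0n //=.
rewrite mulrC ![(_ * t)%N]mulnC.
exact: (@le_bigmax_cond _ _ _ 0 (S c) (vertex_separator E U V)
  (fun S => q ^+ (t * #|edges_in E S|)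
     * n%:R ^+ (t * (m - #|S| + #|isolated_vertices E U V|)))).
Qed.

Lemma pattern_class_le (f : {ffun slot -> slot * bool}) :
  \sum_(x : embs | good U V x && covered x && (pattern ends x == f)) bias p ^+ excess x
  <= n%:R ^+ m * Y.
Proof.
have Y0 := maxterm_ge0.
set A := [set x : embs | good U V x && covered x && (pattern ends x == f)].
have AP x : x \in A -> [/\ forall c, injective (x c), consistent (blink U V) x,
    covered x & pattern ends x = f].
  rewrite inE => /andP[/andP[/andP[/forallP inj ?] ?] /eqP ?]; split=> // c.
  exact/injectiveP.
rewrite (eq_bigl (mem A)) => [|x]; last by rewrite !inE.
have [->|[x0 x0A]] := set_0Vmem A; first by rewrite big_set0 mulr_ge0 ?exprn_ge0 ?ler0n.
have [x0_inj _ /forallP x0_cov x0f] := AP _ x0A.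
have cov sl : exists2 sl', sl' != sl & slot_edge ends x0 sl' = slot_edge ends x0 sl.
  by have /existsP[sl' /andP[ne /eqP e]] := x0_cov sl; exists sl'.
rewrite (eq_bigr (fun _ => bias p ^+ excess x0)) => [|x /AP[_ _ _ xf]]; last first.
  by rewrite (@excess_pattern x x0) // xf.
rewrite sumr_const -[_ *+ #|A|]mulr_natl.
have Aclass x : x \in A -> pattern ends x = pattern ends x0 /\ consistent (blink U V) x.
  by case/AP => _ ? _ ->.
have cF := card_pattern_class (@cpos t) Aclass.
have cL := card_pattern_class (@rpos t) Aclass.
have sepS := sep_separator U V end_set_inj x0_inj cov.
have sumFL := sum_unforced U V end_set_inj x0_inj cov.
have sumE := sum_edges_in U V end_set_inj x0_inj.
(* The image of an edge end lies in ['I_n]; [n > 0] makes powers of [n] monotone in the exponent. *)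
have n_gt0 : (0 < n)%N.
  have [e0 _] := card_gt0P Ed_gt0.
  exact: leq_ltn_trans (leq0n _) (ltn_ord (x0 (ord0, true) (ends e0).1)).
(* Squaring makes room for both bounds on the size of the class, forward and backward, and turns
   [bias] into [q]. *)
rewrite -(@ler_pXn2r _ 2) ?nnegrE ?mulr_ge0 ?exprn_ge0 ?ler0n ?(ltW (bias_gt0 _ _)) //.
rewrite !exprMn.
have -> : (bias p ^+ excess x0) ^+ 2 = q ^+ excess x0.
  by rewrite exprAC bias_sqr.
have := prod_separators sepS.
set a := (\sum_c _)%N in sumFL *; set b := (\sum_c _)%N in sumE *.
move=> le_ab.
apply: (@le_trans _ _ (n%:R ^+ (2 * m + a) * q ^+ b)); last first.
  by rewrite exprD -mulrA mulnC [n%:R ^+ (m * 2)]exprM ler_wpM2l ?exprn_ge0 ?ler0n.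
apply: ler_pM; rewrite ?exprn_ge0 ?ler0n ?(le_trans ler01) ?odds_ge1 //.
  rewrite -!natrX ler_nat -mulnn.
  apply: leq_trans (leq_mul cF cL) _; rewrite -expnD.
  exact: leq_pexp2l.
by rewrite ler_weXn2l // odds_ge1.
Qed.

(* Every slot has a representative slot and an orientation bit, and there are
   [2te] slots; the base is [(4te)^2]. *)
Lemma card_patterns :
  #|{: {ffun slot -> slot * bool}}| = ((16 * t ^ 2 * #|Ed| ^ 2) ^ (t * #|Ed|))%N.
Proof.
rewrite card_ffun !card_prod card_ord !card_bool.
rewrite -[in RHS](_ : ((t * 2 * #|Ed| * 2) ^ 2 = 16 * t ^ 2 * #|Ed| ^ 2)%N); last by lia.
by rewrite -expnM; congr (_ ^ _)%N; lia.
Qed.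

Lemma expect_schatten_bound :
  expect p (fun w : outcome n => schatten_pow (graph_matrix p E U V w) t)
  <= (16 * t ^ 2 * #|Ed| ^ 2)%N%:R ^+ (t * #|Ed|) * (n%:R ^+ m * Y).
Proof.
apply: (le_trans (@expect_schatten_le n m s Ed ends U V end_set_inj p)).
apply: (@le_trans _ _ (\sum_(x : embs | good U V x && covered x) bias p ^+ excess x)).
  rewrite [leRHS]big_mkcondr /=; apply: ler_sum => x /andP[/forallP x_inj _].
  apply: norm_expect_Gval_monomial => // -[c e].
  exact/card_slot_edge/injectiveP.
rewrite (partition_big (pattern ends) xpredT) //=.
apply: (le_trans (ler_sum _ (fun f _ => pattern_class_le f))).
by rewrite sumr_const -[_ ^+ (t * #|Ed|)]natrX -card_patterns mulr_natl.
Qed.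

End Assembly.

(** * From indexed edges with ordered ends to the edge set of a shape *)

Lemma edge_ends m (E : {set {set 'I_m}}) : (forall e, e \in E -> #|e| = 2%N) ->
  exists ends : 'I_#|E| -> 'I_m * 'I_m, forall i, end_set ends i = enum_val i.
Proof.
move=> E2.
have /fin_all_exists[ends endsP] : forall i : 'I_#|E|,
    exists ab : 'I_m * 'I_m, [set ab.1; ab.2] = enum_val i.
  move=> i; have /eqP/cards2P[a [b [_ ->]]] := E2 _ (enum_valP i).
  by exists (a, b).
by exists ends.
Qed.

Lemma expect_const p n (a : R) : expect p (fun _ : outcome n => a) = a.
Proof.
have E1 : expect p (fun _ : outcome n => 1) = 1.
  have := @expect_prod p n (fun _ _ => 1).
  under eq_expect do rewrite big1_eq.
  by move=> ->; rewrite big1 // => f _; rewrite !mulr1 addrC subrK.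
rewrite -[RHS]mulr1 -[in RHS]E1 -expectZ.
by apply: eq_expect => w; rewrite mulr1.
Qed.

Theorem mainTheorem18 :
  exists C : R, 0 < C /\
  forall (p : R) (n m : nat) (E : {set {set 'I_m}}) (U V : seq 'I_m) (t : nat),
    0 < p -> p <= 2^-1 ->
    (forall e, e \in E -> #|e| = 2%N) ->
    uniq U -> uniq V ->
    (2 <= t)%N -> ~~ odd t ->
    expect p (fun w : outcome n => schatten_pow
                (fun I J : Idx n => graph_matrix p E U V w I J
                            - expect p (fun w' : outcome n => graph_matrix p E U V w' I J)) t)
    <= (n%:R ^+ m * m%:R ^+ (t * m)
        * (C * t%:R ^+ 3 * (#|E|%:R) ^+ 5) ^+ (t * #|E|))
       * \big[Num.max/0]_(S : {set 'I_m} | vertex_separator E U V S)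
           (((1 - p) / p) ^+ (t * #|edges_in E S|)
            * n%:R ^+ (t * (m - #|S| + #|isolated_vertices E U V|))).
Proof.
(* The constant comes from the number [(16 t^2 e^2) ^ (te)] of patterns. *)
exists 16%:R; split=> [|p n m E U V t p_gt0 p_le E2 _ _ t_ge2 _]; first by rewrite ltr0n.
set Y := \big[_/_]_(S | _) _.
have Y_ge0 : 0 <= Y by apply: bigmax_ge_id.
have [E0|E_gt0] := posnP #|E|.
  (* Without edges the matrix is deterministic, so the centred matrix is zero, and [t > 0] makes its
     norm zero. *)
  under eq_expect => w.
    under eq_schatten_pow => I J.
      rewrite (_ : expect p _ = graph_matrix p E U V w I J); first rewrite subrr; first over.
      rewrite -[RHS](expect_const p n); apply: eq_expect => w'.
      by rewrite (cards0_eq E0); apply: eq_bigr => phi _; rewrite !big_set0.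
    rewrite schatten_pow0; first over; exact: ltnW.
  by rewrite expect_const !mulr_ge0 ?exprn_ge0 ?mulr_ge0 ?exprn_ge0 ?ler0n.
case: t t_ge2 @Y Y_ge0 => // s _ Y Y_ge0.
have [ends endsE] := edge_ends E2.
have ends_inj : injective (end_set ends) by move=> i j; rewrite !endsE => /enum_val_inj.
have codomE : E = [set end_set ends i | i : 'I_#|E|].
  apply/setP => e; apply/idP/imsetP => [eE|[i _ ->]]; last by rewrite endsE enum_valP.
  by exists (enum_rank_in eE e); rewrite // endsE enum_rankK_in.
have cardE i : #|end_set ends i| = 2%N by rewrite endsE E2 // enum_valP.
have Ed_gt0 : (0 < #|'I_#|E| |)%N by rewrite card_ord.
have m_gt0 := leq_ltn_trans (leq0n _) (ltn_ord (ends (Ordinal E_gt0)).1).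
have mean0 (I J : Idx n) := expect_graph_matrix U V p_gt0 p_le ends_inj cardE Ed_gt0 I J.
have := @expect_schatten_bound p n m s _ ends U V p_gt0 p_le ends_inj cardE Ed_gt0.
rewrite card_ord -codomE -/Y => bound.
(* With an edge present the mean vanishes, so centring changes nothing. *)
have -> : expect p (fun w : outcome n => schatten_pow
    (fun I J : Idx n => graph_matrix p E U V w I J
       - expect p (fun w' : outcome n => graph_matrix p E U V w' I J)) s.+1)
    = expect p (fun w : outcome n => schatten_pow (graph_matrix p E U V w) s.+1).
  apply: eq_expect => w; apply: eq_schatten_pow => I J.
  by rewrite codomE mean0 subr0.
apply: le_trans bound _; rewrite mulrA ler_wpM2r // mulrC -mulrA ler_wpM2l ?exprn_ge0 ?ler0n //.
rewrite -!natrX -!natrM -!natrX -natrM ler_nat.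
(* What remains is [m ^ (tm) >= 1] and [16 t^2 e^2 <= 16 t^3 e^5], with [m], [t] and [e]
   positive. *)
apply: leq_trans (leq_pmull _ _); last by rewrite expn_gt0 m_gt0.
rewrite leq_exp2r ?muln_gt0 ?E_gt0 //.
by apply: leq_mul; [apply: leq_mul => //|]; apply: leq_pexp2l.
Qed.
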